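(* Let $a,r,h,g$ be positive integers with $ga+h<gr$, and put $n=rg$. Then there exists an MR $(n,r,h,a)$-LRC over a field of size \[\ell\le\left(\max\left\{\tilde O\!\left(\tfrac nr\right),\ (2r)^{r}\right\}\right)^{\min\{h,\frac nr\}}.\]
   Context: $\tilde O(f)$ denotes $f\cdot(\log f)^{O(1)}$. Definition: let $\ell$ be a prime power, $a,g,r,h$ positive integers with $ga+h<gr$, $n=gr$, $k=n-ga-h$. An MR (maximally recoverable) $(n,r,h,a)_\ell$-LRC is an $[n,k]$ linear code over $\mathbb{F}_\ell$ with a parity-check matrix $H$ of the block form whose first $ga$ rows are block diagonal with diagonal blocks $A_1,\dots,A_g$ (each $a\times r$, coordinates split into $g$ consecutive groups of size $r$) and whose last $h$ rows are $(D_1|\cdots|D_g)$ with each $D_i$ of size $h\times r$, such that (i) each $A_i$ generates an $[r,a,r-a+1]_\ell$ MDS code, and (ii) every set of $ag+h$ columns of $H$ consisting of any $a$ columns from each group together with any $h$ further columns is linearly independent over $\mathbb{F}_\ell$. ''Over a field of size $\ell$'' means an MR $(n,r,h,a)_\ell$-LRC. *)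

(* Defs.v *)
From HB Require Import structures.
From mathcomp Require Import all_boot all_order all_algebra all_field.
Set Implicit Arguments. Unset Strict Implicit. Unset Printing Implicit Defensive.
Import GRing.Theory.
Local Open Scope ring_scope.

Section LRC.
Variable F : fieldType.

Definition mxget m n (M : 'M[F]_(m, n)) (i j : nat) : F :=
  match (insub i : option 'I_m), (insub j : option 'I_n) with
  | Some i', Some j' => M i' j'
  | _, _ => 0
  end.

Definition wt n (v : 'rV[F]_n) : nat := #|[set j : 'I_n | v 0 j != 0]|.

Definition MDS_generator k n (G : 'M[F]_(k, n)) : Prop :=
  [/\ \rank G = k,
      (forall v : 'rV[F]_n, (v <= G)%MS -> v != 0 -> (n - k + 1 <= wt v)%N)
    & exists2 v : 'rV[F]_n, (v <= G)%MS /\ v != 0 & wt v = (n - k + 1)%N].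

(* The parity-check matrix H of block form: columns q = i*r + j (group i,
   position j); first g*a rows block diagonal with blocks A_i, last h rows
   (D_1 | ... | D_g). *)
Definition lrc_pcm g r h a (A : 'I_g -> 'M[F]_(a, r)) (D : 'I_g -> 'M[F]_(h, r))
  : 'M[F]_(g * a + h, g * r) :=
  \matrix_(p < g * a + h, q < g * r)
    match (insub (q %/ r)%N : option 'I_g) with
    | Some i =>
        if (p < g * a)%N then
          (if (p %/ a == q %/ r)%N then mxget (A i) (p %% a) (q %% r) else 0)
        else mxget (D i) (p - g * a) (q %% r)
    | None => 0
    end.

Definition cols_independent m N (H : 'M[F]_(m, N)) (S : {set 'I_N}) : Prop :=
  row_free (colsub (@enum_val _ (mem S)) H)^T.

Definition MR_condition g r h a (H : 'M[F]_(g * a + h, g * r)) : Prop :=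
  forall (T : 'I_g -> {set 'I_(g * r)}) (E : {set 'I_(g * r)}),
    (forall i : 'I_g, T i \subset [set q : 'I_(g * r) | (q %/ r)%N == i] /\ #|T i| = a) ->
    #|E| = h ->
    [disjoint E & \bigcup_(i < g) T i] ->
    cols_independent H (E :|: \bigcup_(i < g) T i).

Definition MR_LRC g r h a : Prop :=
  exists (A : 'I_g -> 'M[F]_(a, r)) (D : 'I_g -> 'M[F]_(h, r)),
    (forall i, MDS_generator (A i)) /\ MR_condition (lrc_pcm A D).

End LRC.

(* Main.v *)
(* Take q = 2 ^ up_log 2 r, so that r <= q <= 2 r, and let E and L be the
   extensions of F = GF(q) of degrees w = max(r, up_log q g) and m w, where
   m = min(h, g).  Every local block is the a x r Vandermonde matrix on r
   distinct nodes of F, hence MDS.  Column j of global block i is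
   (gam_ij ^+ q ^ s)_(s < h), where gam_ij in L lists the F-coordinates of the
   vector (x_i ^+ s * lam_j)_(s < m) of E^m, with distinct x_i in E and
   F-independent lam_j in E.

   Let Y be a dependency among the selected columns.  On each group the local
   rows determine Y from its values at the h extra columns t: Y = sum_t Y_t c_t,
   where c_t is the kernel vector of the local block supported on the selected
   columns of the group and t, with c_t(t) = 1.  The global rows then read
   sum_t Y_t mu_t ^+ q ^ s = 0 for s < h, with mu_t = sum c_t(q) gam_q.  The mu_t
   are F-independent, since an F-relation among the gam's from at most m groups
   is killed by an m x m Vandermonde argument in E; so their Moore matrix is
   invertible and Y = 0.  Finally #|L| = (q ^ w) ^ m, where q ^ w <= (2 r) ^ r
   if w = r, and otherwise 2 ^ r <= q ^ (w - 1) < g, so that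
   q ^ w <= 2 r g <= 2 g (log2 g + 1). *)

Require Import Defs.
From HB Require Import structures.
From mathcomp Require Import all_boot all_order all_algebra all_field.
From mathcomp Require Import zify.
Set Implicit Arguments. Unset Strict Implicit. Unset Printing Implicit Defensive.
Import GRing.Theory.
Local Open Scope ring_scope.

Lemma card_finFieldExt (F : finFieldType) (L : fieldExtType F) :
  #|FinFieldExtType L| = (#|F| ^ \dim {:L})%N.
Proof. by rewrite -(card_vspace (fullv : {vspace finvect_type L})) card_vspacef. Qed.

Lemma natr_card_finField (F : finFieldType) : (#|F|%:R : F) = 0.
Proof.
have [p _ pcharF] := finPcharP F; have cardF := card_pprimeChar pcharF.
rewrite [in LHS]cardF natrX (pcharf0 pcharF) expr0n; case: eqP => // logF0.
by have := finNzRing_gt1 F; rewrite cardF logF0.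
Qed.

(* The proof of [pPrimePowerField], over an arbitrary finite base field: the
   splitting field of 'X^(q^k) - 'X is the fixed field of the k-th power of
   the Frobenius generator of its Galois group. *)
Lemma finFieldExt_exists (F : finFieldType) k :
  (0 < k)%N -> {L : fieldExtType F | \dim {:L} = k}.
Proof.
move=> k_gt0; set m := (#|F| ^ k)%N; have F_gt1 := finNzRing_gt1 F.
have m_gt1: (m > 1)%N by rewrite /m (ltn_exp2l 0).
have m_gt0 := ltnW m_gt1; have m1_gt0: (m.-1 > 0)%N by rewrite -ltnS prednK.
have mF0 : (m%:R : F) = 0 by rewrite natrX natr_card_finField expr0n gtn_eqF.
have Dq (R : nzRingType) : ('X^m - 'X : {poly R}) = ('X^(m.-1) - 1) * ('X - 0).
  by rewrite subr0 mulrBl mul1r -exprSr prednK.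
have /FinSplittingFieldFor[/= L splitLq]: ('X^m - 'X : {poly F}) != 0.
  by rewrite Dq monic_neq0 ?rpredM ?monicXsubC ?monicXnsubC.
rewrite [map_poly _ _]rmorphB rmorphXn /= map_polyX in splitLq.
exists L; apply: (expnI F_gt1); rewrite -card_finFieldExt.
have /finField_galois_generator[/= a _ Da]: (1 <= {:L})%VS by apply: sub1v.
pose Em := fixedSpace (a ^+ k)%g; rewrite dimv1 expn1 in Da.
have{splitLq} [zs DqL defL] := splitLq.
have Uzs: uniq zs.
  rewrite -separable_prod_XsubC -(eqp_separable DqL) Dq separable_root andbC.
  rewrite /root !hornerE subr_eq0 eq_sym expr0n gtn_eqF ?oner_eq0 //=.
  rewrite cyclotomic.separable_Xn_sub_1 // -subn1 natrB // subr_eq0.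
  by rewrite -(rmorph_nat (in_alg L)) mF0 rmorph0 eq_sym oner_eq0.
suffices /eq_card->: FinFieldExtType L =i zs.
  apply: succn_inj; rewrite (card_uniqP _) //= -(size_prod_XsubC _ id).
  by rewrite -(eqp_size DqL) size_polyDl size_polyXn // size_polyN size_polyX.
have in_zs: zs =i Em.
  move=> z; rewrite -root_prod_XsubC -(eqp_root DqL) (sameP fixedSpaceP eqP).
  rewrite /root !hornerE subr_eq0 /= /m; congr (_ == z).
  elim: (k) => [|i IHi]; first by rewrite gal_id.
  by rewrite expgSr expnSr exprM IHi galM ?Da ?memvf.
suffices defEm: Em = {:L}%VS by move=> z; rewrite in_zs defEm memvf.
apply/eqP; rewrite eqEsubv subvf -defL -[Em]subfield_closed agenvS //.
by rewrite subv_add sub1v; apply/span_subvP=> z; rewrite in_zs.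
Qed.

Lemma unitmx_kernel_enum (K : fieldType) (I : finType) (P : {pred I})
    (M : 'M[K]_#|P|) (y : I -> K) :
  M \in unitmx -> (forall s, \sum_l M s l * y (enum_val l) = 0) ->
  {in P, forall i, y i = 0}.
Proof.
move=> M_unit y_ker i Pi; pose Y := \col_(l < #|P|) y (enum_val l).
suff /colP/(_ (enum_rank_in Pi i)) : Y = 0 by rewrite !mxE enum_rankK_in.
rewrite -(mulKmx M_unit Y) (_ : M *m Y = 0) ?mulmx0 //.
by apply/colP => s; rewrite !mxE -[RHS](y_ker s); apply: eq_bigr => l _; rewrite mxE.
Qed.

Section Frobenius.
Variables (F : finFieldType) (L : fieldExtType F).
Local Notation q := #|F|.

Let q_gt1 : (1 < q)%N := finNzRing_gt1 F.

Lemma expr_cardX_sum s (I : Type) (r : seq I) (P : pred I) (f : I -> L) :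
  (\sum_(i <- r | P i) f i) ^+ (q ^ s) = \sum_(i <- r | P i) f i ^+ (q ^ s).
Proof.
have [p _ pcharF] := finPcharP F.
have qs_nat : [pchar L].-nat (q ^ s)%N.
  rewrite [X in (X ^ s)%N](card_pprimeChar pcharF) -expnM pnatX.
  have pcharL : p \in [pchar L] by rewrite pchar_lalg.
  by rewrite (pnatE _ (pcharf_prime pcharL)) pcharL.
apply: (big_morph (fun x => x ^+ (q ^ s))) => [x y|]; first exact: exprDn_pchar.
by rewrite expr0n expn_eq0 (negPf (lt0n_neq0 (ltnW q_gt1))) ?andbF.
Qed.

Lemma expf_cardX s (c : F) : c ^+ (q ^ s) = c.
Proof. by elim: s => [|s IH]; rewrite ?expr1 // expnSr exprM IH expf_card. Qed.

Lemma exprZ_cardX s (c : F) (x : L) : (c *: x) ^+ (q ^ s) = c *: x ^+ (q ^ s).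
Proof. by rewrite exprZn expf_cardX. Qed.

Definition moore_mx h (mu : 'I_h -> L) : 'M[L]_h := \matrix_(s, t) mu t ^+ (q ^ s).

(* Each x |-> x ^+ q ^ s is F-linear on L, so the roots of this polynomial
   form an F-subspace. *)
Lemma linearized_root_span h (mu : 'I_h -> L) (w : 'rV[L]_h) (c : 'I_h -> F) :
  w *m moore_mx mu = 0 ->
  (\sum_(s < h) w 0 s *: 'X^(q ^ s) : {poly L}).[\sum_t c t *: mu t] = 0.
Proof.
move=> /rowP w_ker; rewrite horner_sum.
under eq_bigr => s _ do rewrite hornerZ hornerXn expr_cardX_sum mulr_sumr.
rewrite exchange_big /= big1 // => t _.
under eq_bigr => s _ do rewrite exprZ_cardX -scalerAr.
have := w_ker t; rewrite !mxE => w_t.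
rewrite -scaler_sumr -[RHS](scaler0 _ (c t)); congr (_ *: _).
by rewrite -[RHS]w_t; apply: eq_bigr => s _; rewrite mxE.
Qed.

Lemma moore_row_free h (mu : 'I_h -> L) :
  (forall c : 'I_h -> F, \sum_i c i *: mu i = 0 -> forall i, c i = 0) ->
  row_free (moore_mx mu).
Proof.
move=> mu_free; apply: inj_row_free => w w_ker.
apply/rowP => s0; rewrite mxE; apply/eqP; apply/negPn/negP => ws0.
pose P : {poly L} := \sum_(s < h) w 0 s *: 'X^(q ^ s).
have P_neq0 : P != 0.
  apply/eqP => /(congr1 (fun p : {poly L} => p`_(q ^ s0))).
  rewrite coef0 /P coef_sum (bigD1 s0) //= big1 ?addr0.
    by rewrite coefZ coefXn eqxx mulr1 => /eqP; rewrite (negPf ws0).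
  move=> s ns; rewrite coefZ coefXn eqn_exp2l ?q_gt1 //.
  by rewrite (inj_eq val_inj) eq_sym (negPf ns) mulr0.
have h_gt0 : (0 < h)%N by apply: leq_ltn_trans (ltn_ord s0).
have size_P : (size P <= (q ^ h.-1).+1)%N.
  apply: leq_trans (size_sum _ _ _) _; apply/bigmax_leqP => s _.
  apply: leq_trans (size_scale_leq _ _) _.
  by rewrite size_polyXn ltnS leq_exp2l ?q_gt1 // -ltnS prednK.
pose span := [seq \sum_t c t *: mu t | c : {ffun 'I_h -> F}].
have span_uniq : uniq span.
  rewrite map_inj_uniq ?enum_uniq // => c c' e.
  apply/ffunP => t; apply/eqP; rewrite -subr_eq0; apply/eqP.
  move: t; apply: (mu_free (fun t => c t - c' t)).
  by under eq_bigr => t _ do rewrite scalerBl; rewrite sumrB e subrr.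
have span_roots : all (root P) span.
  by apply/allP => z /mapP[c _ ->]; apply/rootP; apply: linearized_root_span.
have := max_poly_roots P_neq0 span_roots span_uniq.
rewrite size_map -cardE card_ffun card_ord => /leq_trans /(_ size_P).
rewrite ltnS -(prednK h_gt0) expnS -{2}(mul1n (_ ^ _)%N) leq_mul2r.
by rewrite expn_eq0 eqn0Ngt (ltnW q_gt1) /= leqNgt q_gt1.
Qed.

Lemma moore_kernel (I : finType) (A : {pred I}) (mu y : I -> L) :
  (forall b : I -> F, \sum_(i in A) b i *: mu i = 0 -> {in A, forall i, b i = 0}) ->
  (forall s, (s < #|A|)%N -> \sum_(i in A) y i * mu i ^+ (q ^ s) = 0) ->
  {in A, forall i, y i = 0}.
Proof.
move=> mu_free y_ker.
apply: (@unitmx_kernel_enum _ _ _ (moore_mx (fun l => mu (enum_val l)))) => [|s].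
  rewrite -row_free_unit; apply: moore_row_free => c c_ker l.
  pose b i := c (enum_rank_in (enum_valP l) i).
  have := mu_free b _ _ (enum_valP l); rewrite /b enum_valK_in; apply.
  by rewrite big_enum_val -[RHS]c_ker; apply: eq_bigr => l' _; rewrite enum_valK_in.
rewrite -[RHS](y_ker s (ltn_ord s)) [RHS]big_enum_val.
by apply: eq_bigr => l _; rewrite mxE mulrC.
Qed.

End Frobenius.

Lemma widen_ord_inj n m (le_nm : (n <= m)%N) : injective (widen_ord le_nm).
Proof. by move=> i j [] /val_inj. Qed.

Section Vandermonde.
Variable K : fieldType.

Lemma vander_unit n (x : 'I_n -> K) :
  injective x -> Vandermonde n (\row_l x l) \in unitmx.
Proof.
move=> x_inj; rewrite unitmxE det_Vandermonde unitfE.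
apply/prodf_neq0 => i _; apply/prodf_neq0 => j ij; rewrite !mxE subr_eq0.
by apply: contraTneq ij => /x_inj ->; rewrite ltnn.
Qed.

Lemma sum_mul_pow_eq0 (I : finType) (P : {pred I}) (x v : I -> K) m :
  {in P &, injective x} -> (#|P| <= m)%N ->
  (forall s, (s < m)%N -> \sum_(i in P) v i * x i ^+ s = 0) ->
  {in P, forall i, v i = 0}.
Proof.
move=> x_inj Pm v_ker.
have xP_inj : injective (fun l : 'I_#|P| => x (enum_val l)).
  by move=> l l' /x_inj; rewrite !enum_valP => /(_ isT isT)/enum_val_inj.
apply: (unitmx_kernel_enum (vander_unit xP_inj)) => s.
rewrite -[RHS](v_ker s (leq_trans (ltn_ord s) Pm)) [RHS]big_enum_val.
by apply: eq_bigr => l _; rewrite !mxE mulrC.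
Qed.

Lemma poly_eq0_of_roots (I : finType) (P : {pred I}) (x : I -> K) (p : {poly K}) :
  {in P &, injective x} -> (size p <= #|P|)%N -> {in P, forall i, root p (x i)} ->
  p = 0.
Proof.
move=> x_inj size_p p_roots; apply: (@roots_geq_poly_eq0 _ _ [seq x i | i in P]).
- by apply/allP => z /mapP[i]; rewrite mem_enum => Pi ->; apply: p_roots.
- by rewrite map_inj_in_uniq ?enum_uniq // => i j; rewrite !mem_enum; apply: x_inj.
- by rewrite size_map -cardE.
Qed.

Lemma vander_dependency (I : finType) (T : {pred I}) (x : I -> K) t :
  {in T &, injective x} -> t \notin T ->
  exists c : I -> K, [/\ c t = 1, forall i, i \notin T -> i != t -> c i = 0 &
    forall k, (k < #|T|)%N -> \sum_i c i * x i ^+ k = 0].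
Proof.
move=> x_inj tT; pose e := @enum_val I (mem T).
have xT_inj : injective (fun l => x (e l)).
  by move=> l l' /x_inj; rewrite !enum_valP => /(_ isT isT)/enum_val_inj.
pose V := Vandermonde #|T| (\row_l x (e l)).
have [w Vw] : exists w, V *m w = \col_(k < #|T|) - x t ^+ k.
  by exists (invmx V *m \col_k - x t ^+ k); rewrite mulKVmx ?vander_unit.
have e_neq l i : i \notin T -> (e l == i) = false.
  by move=> iT; apply: contraNF iT => /eqP <-; apply: enum_valP.
exists (fun i => (i == t)%:R + \sum_l w l 0 * (e l == i)%:R); split.
- by rewrite eqxx big1 ?addr0 // => l _; rewrite e_neq ?mulr0.
- by move=> i iT /negPf->; rewrite add0r big1 // => l _; rewrite e_neq ?mulr0.
move=> k kT; under eq_bigr => i _ do rewrite mulrDl mulr_suml.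
rewrite big_split /= (bigD1 t) //= eqxx mul1r big1 ?addr0; last first.
  by move=> i /negPf->; rewrite mul0r.
rewrite exchange_big /=.
have /colP/(_ (Ordinal kT)) := Vw; rewrite !mxE /= => Vw_k.
apply/eqP; rewrite addrC addr_eq0 -Vw_k; apply/eqP.
apply: eq_bigr => l _; rewrite !mxE (bigD1 (e l)) //= eqxx mulr1 big1 ?addr0.
  by rewrite mulrC.
by move=> i /negPf; rewrite eq_sym => ->; rewrite mulr0 mul0r.
Qed.

Lemma wt0 n : wt (0 : 'rV[K]_n) = 0%N.
Proof. by apply: eq_card0 => j; rewrite !inE mxE eqxx. Qed.

Section MDS.
Variables (a r : nat) (al : 'I_r -> K).
Hypotheses (al_inj : injective al) (a_gt0 : (0 < a)%N) (a_le_r : (a <= r)%N).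
Local Notation A := (Vandermonde a (\row_j al j)).

Lemma vander_mulE (u : 'rV[K]_a) (j : 'I_r) : (u *m A) 0 j = (rVpoly u).[al j].
Proof.
rewrite mxE (horner_coef_wide _ (size_poly _ _)).
by apply: eq_bigr => k _; rewrite coef_rVpoly_ord !mxE.
Qed.

Lemma vander_mul_eq0 (u : 'rV[K]_a) : (wt (u *m A) <= r - a)%N -> u = 0.
Proof.
move=> low_wt; pose Z := [set j | (u *m A) 0 j == 0].
have card_Z : (a <= #|Z|)%N.
  have := cardsC Z; rewrite card_ord.
  have -> : #|~: Z| = wt (u *m A) by apply: eq_card => j; rewrite !inE.
  by lia.
rewrite -[u]rVpolyK (@poly_eq0_of_roots _ Z al (rVpoly u)) ?linear0 //.
- by move=> j j' _ _ /al_inj.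
- exact: leq_trans (size_poly _ _) card_Z.
- by move=> j; rewrite inE vander_mulE.
Qed.

Lemma vander_MDS : MDS_generator A.
Proof.
split.
- apply/eqP; apply: inj_row_free => u uA0; apply: vander_mul_eq0.
  by rewrite uA0 wt0.
- move=> v /submxP[u ->]; apply: contraNT; rewrite -ltnNge => low_wt.
  by rewrite (vander_mul_eq0 (u := u)) ?mul0mx //; lia.
have a1r : (a.-1 <= r)%N by rewrite (leq_trans (leq_pred a)).
pose Z := [set widen_ord a1r k | k : 'I_a.-1].
have card_Z : #|Z| = a.-1 by rewrite card_imset ?card_ord //; apply: widen_ord_inj.
pose p := \prod_(k < a.-1) ('X - (al (widen_ord a1r k))%:P).
have size_p : (size p <= a)%N.
  by rewrite size_prod_XsubC /index_enum -enumT size_enum_ord prednK.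
have p_root j : (p.[al j] == 0) = (j \in Z).
  rewrite horner_prod prodf_seq_eq0; apply/hasP/imsetP => [[k _]|[k _ ->]].
    by rewrite !hornerE subr_eq0 => /eqP/al_inj ->; exists k.
  by exists k; rewrite ?mem_index_enum // !hornerE subrr.
have wt_p : wt (poly_rV p *m A) = (r - a + 1)%N.
  rewrite /wt (_ : [set j | _] = ~: Z); last first.
    by apply/setP => j; rewrite !inE vander_mulE poly_rV_K // p_root.
  by rewrite cardsCs setCK card_Z card_ord; lia.
exists (poly_rV p *m A) => //; split; first exact: submxMl.
by apply: contra_eqN wt_p => /eqP->; rewrite wt0 addn1.
Qed.

End MDS.

End Vandermonde.

Section ColumnIndex.
Variables g r : nat.

Lemma ord_mul_gt0 (q : 'I_(g * r)) : (0 < r)%N.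
Proof. by case: q => q /=; case: r => //; rewrite muln0. Qed.

Lemma grp_subproof (q : 'I_(g * r)) : (q %/ r < g)%N.
Proof. by rewrite ltn_divLR ?ord_mul_gt0. Qed.

Lemma idx_subproof (i : 'I_g) (j : 'I_r) : (i * r + j < g * r)%N.
Proof.
have : (i.+1 * r <= g * r)%N by rewrite leq_mul2r ltn_ord orbT.
by rewrite mulSn; have := ltn_ord j; lia.
Qed.

Definition grp (q : 'I_(g * r)) : 'I_g := Ordinal (grp_subproof q).
Definition pos (q : 'I_(g * r)) : 'I_r := Ordinal (ltn_pmod q (ord_mul_gt0 q)).
Definition idx (i : 'I_g) (j : 'I_r) : 'I_(g * r) := Ordinal (idx_subproof i j).

Lemma grp_idx i j : grp (idx i j) = i.
Proof.
have r_gt0 : (0 < r)%N by apply: leq_ltn_trans (ltn_ord j).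
by apply: val_inj; rewrite /= divnMDl // divn_small // addn0.
Qed.

Lemma pos_idx i j : pos (idx i j) = j.
Proof. by apply: val_inj; rewrite /= modnMDl modn_small. Qed.

Lemma idx_grp_pos q : idx (grp q) (pos q) = q.
Proof. by apply: val_inj; rewrite /= -divn_eq. Qed.

Lemma grp_pos_inj q q' : grp q = grp q' -> pos q = pos q' -> q = q'.
Proof. by move=> eq_grp eq_pos; rewrite -(idx_grp_pos q) -(idx_grp_pos q') eq_grp eq_pos. Qed.

Lemma sum_in_grp (V : nmodType) (F : 'I_(g * r) -> V) i :
  \sum_(q | grp q == i) F q = \sum_(j < r) F (idx i j).
Proof.
rewrite (reindex_onto (idx i) pos) /=; last by move=> q /eqP <-; rewrite idx_grp_pos.
by apply: eq_bigl => j; rewrite grp_idx pos_idx !eqxx.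
Qed.

Lemma sum_by_grp (V : nmodType) (G : {pred 'I_g}) (F : 'I_(g * r) -> V) :
  \sum_(q | grp q \in G) F q = \sum_(i in G) \sum_(j < r) F (idx i j).
Proof.
rewrite (partition_big grp (mem G)) //=; apply: eq_bigr => i iG.
by rewrite -sum_in_grp; apply: eq_bigl => q; case: eqP => [->|]; rewrite ?iG ?andbF.
Qed.

End ColumnIndex.

Section ParityCheckEntries.
Variables (F : fieldType) (g r h a : nat).
Variables (A : 'I_g -> 'M[F]_(a, r)) (D : 'I_g -> 'M[F]_(h, r)).

Lemma mxgetE m n (M : 'M[F]_(m, n)) (i : 'I_m) (j : 'I_n) : mxget M i j = M i j.
Proof.
rewrite /mxget; case: insubP => [i' _ /val_inj->|]; last by rewrite ltn_ord.
by case: insubP => [j' _ /val_inj->|]; last by rewrite ltn_ord.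
Qed.

Lemma insub_grpE (q : 'I_(g * r)) (P : 'I_g -> F) :
  match (insub (q %/ r)%N : option 'I_g) with Some i => P i | None => 0 end =
  P (grp q).
Proof. by rewrite insubT ?grp_subproof // => lt_qr; congr P; apply: val_inj. Qed.

Lemma lrc_pcm_local (i : 'I_g) (k : 'I_a) q :
  lrc_pcm A D (lshift h (idx i k)) q = if grp q == i then A i k (pos q) else 0.
Proof.
have a_gt0 : (0 < a)%N by apply: leq_ltn_trans (ltn_ord k).
rewrite /lrc_pcm mxE insub_grpE /= idx_subproof divnMDl // divn_small // addn0.
rewrite modnMDl modn_small // -[(q %/ r)%N]/(val (grp q)) (inj_eq val_inj) eq_sym.
by case: eqP => // ->; apply: (mxgetE (A i) k (pos q)).
Qed.

Lemma lrc_pcm_global (s : 'I_h) q :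
  lrc_pcm A D (rshift (g * a) s) q = D (grp q) s (pos q).
Proof.
by rewrite /lrc_pcm mxE insub_grpE /= ltnNge leq_addr /= addKn -mxgetE.
Qed.

End ParityCheckEntries.

Lemma coord_sum_free (K : fieldType) (vT : vectType K) n (X : n.-tuple vT)
    (I : finType) (f : I -> 'I_n) (c : I -> K) i :
  free X -> injective f -> coord X (f i) (\sum_i' c i' *: X`_(f i')) = c i.
Proof.
move=> X_free f_inj; rewrite linear_sum (bigD1 i) //= big1 ?addr0.
  by rewrite linearZ /= coord_free // eqxx mulr1.
by move=> i' /negPf ii'; rewrite linearZ /= coord_free // (inj_eq f_inj) ii' mulr0.
Qed.

Section Embedding.
Variables (F : fieldType) (E L : fieldExtType F) (m : nat).
Local Notation w := (\dim {:E}).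
Hypothesis mw_le : (m * w <= \dim {:L})%N.

(* The F-coordinates of [v s] in a basis of E are laid out in consecutive
   blocks of a basis of L. *)
Definition embed (v : 'I_m -> E) : L :=
  \sum_(q < m * w)
    coord (vbasis {:E}) (pos q) (v (grp q)) *: (vbasis {:L})`_(widen_ord mw_le q).

Lemma embed_sum (I : finType) (d : I -> F) (v : I -> 'I_m -> E) :
  \sum_i d i *: embed (v i) = embed (fun s => \sum_i d i *: v i s).
Proof.
under eq_bigr => i _ do rewrite /embed scaler_sumr.
rewrite exchange_big; apply: eq_bigr => q _.
by rewrite linear_sum scaler_suml; apply: eq_bigr => i _; rewrite scalerA linearZ /= mulrC.
Qed.

Lemma embed_eq0 v : embed v = 0 -> forall s, v s = 0.
Proof.
move=> v0 s; have L_free := basis_free (vbasisP (fullv : {vspace L})).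
rewrite (coord_vbasis (memvf (v s))); apply: big1 => k _.
have := coord_sum_free (fun q => coord (vbasis {:E}) (pos q) (v (grp q)))
  (idx s k) L_free (@widen_ord_inj _ _ mw_le).
by rewrite -/(embed v) v0 linear0 grp_idx pos_idx => <-; rewrite scale0r.
Qed.

End Embedding.

Section Gamma.
Variables (F : fieldType) (E L : fieldExtType F) (g r m : nat) (x : 'I_g -> E).
Hypotheses (x_inj : injective x) (r_le_w : (r <= \dim {:E})%N).
Hypothesis mw_le : (m * \dim {:E} <= \dim {:L})%N.

Definition lam (j : 'I_r) : E := (vbasis {:E})`_(widen_ord r_le_w j).

Lemma lam_free (c : 'I_r -> F) : \sum_j c j *: lam j = 0 -> forall j, c j = 0.
Proof.
move=> c0 j; have E_free := basis_free (vbasisP (fullv : {vspace E})).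
rewrite -(coord_sum_free c j E_free (@widen_ord_inj _ _ r_le_w)).
by rewrite -/(lam _); under eq_bigr do rewrite -/(lam _); rewrite c0 linear0.
Qed.

Definition gam (q : 'I_(g * r)) : L := embed mw_le (fun s => x (grp q) ^+ s * lam (pos q)).

Lemma gam_free (G : {set 'I_g}) (d : 'I_(g * r) -> F) :
  (#|G| <= m)%N -> (forall q, grp q \notin G -> d q = 0) ->
  \sum_q d q *: gam q = 0 -> forall q, d q = 0.
Proof.
move=> G_le_m dG; rewrite embed_sum => /embed_eq0 d_ker.
pose v i := \sum_(j < r) d (idx i j) *: lam j.
have v_ker s : (s < m)%N -> \sum_(i in G) v i * x i ^+ s = 0.
  move=> lt_sm; rewrite -[RHS](d_ker (Ordinal lt_sm)) /=.
  rewrite [RHS](bigID (fun q => grp q \in G)) /=.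
  rewrite [X in _ = _ + X]big1 ?addr0 => [|q /dG->]; last by rewrite scale0r.
  rewrite sum_by_grp; apply: eq_bigr => i _; rewrite mulr_suml; apply: eq_bigr => j _.
  by rewrite grp_idx pos_idx -scalerAl mulrC.
have v0 : {in G, forall i, v i = 0}.
  by apply: sum_mul_pow_eq0 v_ker => // i i' _ _ /x_inj.
move=> q; rewrite -(idx_grp_pos q); case: (boolP (grp q \in G)) => [/v0|qG].
  by move/lam_free; apply.
by apply: dG; rewrite grp_idx.
Qed.

End Gamma.

Section Construction.
Variables (F : finFieldType) (E L : fieldExtType F) (g r h a m : nat).
Variables (x : 'I_g -> E) (al : 'I_r -> F).
Hypotheses (x_inj : injective x) (al_inj : injective al).
Hypotheses (r_le_w : (r <= \dim {:E})%N) (mw_le : (m * \dim {:E} <= \dim {:L})%N).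
Hypotheses (hg_le_m : (minn h g <= m)%N) (a_gt0 : (0 < a)%N) (a_le_r : (a <= r)%N).

Local Notation gm := (gam x r_le_w mw_le).

Definition loc_mx : 'M[L]_(a, r) := Vandermonde a (\row_j in_alg L (al j)).
Definition glob_mx (i : 'I_g) : 'M[L]_(h, r) := \matrix_(s, j) gm (idx i j) ^+ (#|F| ^ s).
Local Notation H := (lrc_pcm (fun _ => loc_mx) glob_mx).

Section Selection.
Variables (T : 'I_g -> {set 'I_(g * r)}) (Ex : {set 'I_(g * r)}).
Hypothesis T_grp : forall i, T i \subset [set q : 'I_(g * r) | (q %/ r)%N == i] /\ #|T i| = a.
Hypotheses (card_Ex : #|Ex| = h) (Ex_T : [disjoint Ex & \bigcup_(i < g) T i]).
Local Notation S := (Ex :|: \bigcup_(i < g) T i).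

Lemma grp_T i q : q \in T i -> grp q = i.
Proof.
have [/subsetP sub _] := T_grp i.
by move=> /sub; rewrite inE => /eqP e; apply: val_inj.
Qed.

Lemma Ex_notin_T i t : t \in Ex -> t \notin T i.
Proof.
by move=> tEx; apply: contraFN (disjointFr Ex_T tEx) => tT; apply/bigcupP; exists i.
Qed.

Lemma al_pos_inj i : {in T i &, injective (fun q => al (pos q))}.
Proof. by move=> q q' qT q'T /al_inj; apply: grp_pos_inj; rewrite (grp_T qT) (grp_T q'T). Qed.

Definition is_correction t (ct : 'I_(g * r) -> F) :=
  [/\ ct t = 1, forall q, q \notin T (grp t) -> q != t -> ct q = 0
    & forall k, (k < a)%N -> \sum_q ct q * al (pos q) ^+ k = 0].

Lemma corrections_exist : exists c, forall t, t \in Ex -> is_correction t (c t).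
Proof.
suff /fin_all_exists[c c_spec] : forall t, exists ct, t \in Ex -> is_correction t ct.
  by exists c.
move=> t; have [tEx|] := boolP (t \in Ex); last by exists (fun=> 0).
have [_ card_T] := T_grp (grp t).
have [ct ct_spec] := vander_dependency (@al_pos_inj (grp t)) (Ex_notin_T (grp t) tEx).
by exists ct; rewrite card_T in ct_spec.
Qed.

Variable Y : 'I_(g * r) -> L.
Hypothesis Y_supp : forall q, q \notin S -> Y q = 0.
Hypothesis Y_ker : forall p, \sum_q Y q * H p q = 0.
Variable c : 'I_(g * r) -> 'I_(g * r) -> F.
Hypothesis c_spec : forall t, t \in Ex -> is_correction t (c t).

Lemma Y_local i k : (k < a)%N -> \sum_(q | grp q == i) Y q * in_alg L (al (pos q)) ^+ k = 0.
Proof.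
move=> lt_ka; rewrite -[RHS](Y_ker (lshift h (idx i (Ordinal lt_ka)))) big_mkcond /=.
apply: eq_bigr => q _; rewrite lrc_pcm_local.
by case: eqP => _; rewrite ?mulr0 // !mxE.
Qed.

Lemma Y_global s : (s < h)%N -> \sum_q Y q * gm q ^+ (#|F| ^ s) = 0.
Proof.
move=> lt_sh; rewrite -[RHS](Y_ker (rshift (g * a) (Ordinal lt_sh))).
by apply: eq_bigr => q _; rewrite lrc_pcm_global mxE idx_grp_pos.
Qed.

Lemma c_grp t q : t \in Ex -> c t q != 0 -> grp q = grp t.
Proof.
move=> tEx; have [_ c_out _] := c_spec tEx.
have [/grp_T //|qT] := boolP (q \in T (grp t)).
by have [-> //|qt] := eqVneq q t; rewrite c_out ?eqxx.
Qed.

Lemma c_S t q : t \in Ex -> c t q != 0 -> q \in S.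
Proof.
move=> tEx; have [_ c_out _] := c_spec tEx.
have [qT _|qT] := boolP (q \in T (grp t)).
  by rewrite inE; apply/orP; right; apply/bigcupP; exists (grp t).
by have [-> _|qt] := eqVneq q t; rewrite ?inE ?tEx // c_out ?eqxx.
Qed.

Lemma c_Ex t t' : t \in Ex -> t' \in Ex -> c t t' = if t' == t then 1 else 0.
Proof.
move=> tEx t'Ex; have [c_t c_out _] := c_spec tEx.
by have [->|t't] := eqVneq t' t; rewrite // c_out // Ex_notin_T.
Qed.

Lemma c_local t i k : t \in Ex -> (k < a)%N ->
  \sum_(q | grp q == i) c t q * al (pos q) ^+ k = 0.
Proof.
move=> tEx lt_ka; have [_ _ c_ker] := c_spec tEx.
have [<-|ti] := eqVneq (grp t) i.
  rewrite -[RHS](c_ker k lt_ka) [RHS](bigID (fun q => grp q == grp t)) /=.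
  rewrite [X in _ = _ + X]big1 ?addr0 // => q /negP qt.
  by have [->|/(c_grp tEx)] := eqVneq (c t q) 0; rewrite ?mul0r // => e; case: qt; apply/eqP.
apply: big1 => q /eqP qi; have [->|/(c_grp tEx) e] := eqVneq (c t q) 0; first by rewrite mul0r.
by case/eqP: ti; rewrite -e.
Qed.

Let Z q := Y q - \sum_(t in Ex) Y t * in_alg L (c t q).

Lemma Z_local i k : (k < a)%N -> \sum_(q | grp q == i) Z q * in_alg L (al (pos q)) ^+ k = 0.
Proof.
move=> lt_ka; under eq_bigr => q _ do rewrite mulrBl mulr_suml.
rewrite sumrB Y_local // sub0r exchange_big big1 ?oppr0 // => t tEx.
under eq_bigr => q _ do rewrite -mulrA -rmorphXn -rmorphM.
by rewrite -mulr_sumr -rmorph_sum c_local // rmorph0 mulr0.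
Qed.

Lemma Z_out q : q \notin \bigcup_(i < g) T i -> Z q = 0.
Proof.
move=> qT; have [qEx|qEx] := boolP (q \in Ex).
  rewrite /Z (bigD1 q) // c_Ex // eqxx rmorph1 mulr1 big1 /= ?addr0 ?subrr //.
  move=> t /andP[tEx qt].
  by rewrite c_Ex // eq_sym (negPf qt) scale0r mulr0.
rewrite /Z Y_supp ?inE ?negb_or ?qEx // sub0r big1 ?oppr0 // => t tEx.
have [->|/(c_S tEx)] := eqVneq (c t q) 0; first by rewrite rmorph0 mulr0.
by rewrite inE (negPf qEx) (negPf qT).
Qed.

Lemma Z_eq0 q : Z q = 0.
Proof.
have [/bigcupP[i _ qT]|/Z_out //] := boolP (q \in \bigcup_(i < g) T i).
have al_inj_T : {in T i &, injective (fun q => in_alg L (al (pos q)))}.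
  by move=> q1 q2 q1T q2T /fmorph_inj; apply: al_pos_inj q1T q2T.
have [_ card_T] := T_grp i.
apply: (sum_mul_pow_eq0 al_inj_T (m := a)) => // [|k lt_ka]; first by rewrite card_T.
rewrite -[RHS](Z_local i lt_ka) [RHS](bigID (mem (T i))) /= [X in _ = _ + X]big1.
  rewrite addr0; apply: eq_bigl => q'.
  by case: (boolP (q' \in T i)) => [/grp_T->|]; rewrite ?eqxx ?andbF.
move=> q' /andP[/eqP q'i q'T]; rewrite Z_out ?mul0r //.
by apply/bigcupP => -[i' _ q'T']; move: q'T; rewrite -q'i (grp_T q'T') q'T'.
Qed.

Lemma Y_decomp q : Y q = \sum_(t in Ex) Y t * in_alg L (c t q).
Proof. by apply/eqP; rewrite -subr_eq0; apply/eqP; apply: Z_eq0. Qed.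

Let mu t := \sum_q c t q *: gm q.

Lemma mu_free (b : 'I_(g * r) -> F) :
  \sum_(t in Ex) b t *: mu t = 0 -> {in Ex, forall t, b t = 0}.
Proof.
move=> b_ker t tEx; pose d q := \sum_(t' in Ex) b t' * c t' q.
have d0 : forall q, d q = 0.
  apply: (gam_free x_inj (r_le_w := r_le_w) (mw_le := mw_le) (G := [set grp q | q in Ex])).
  - rewrite (leq_trans _ hg_le_m) // leq_min -card_Ex leq_imset_card.
    by rewrite -[X in (_ <= X)%N](card_ord g) max_card.
  - move=> q qG; apply: big1 => t' t'Ex.
    have [->|/(c_grp t'Ex) e] := eqVneq (c t' q) 0; first by rewrite mulr0.
    by move: qG; rewrite e imset_f.
  - rewrite -[RHS]b_ker; under eq_bigr => q _ do rewrite scaler_suml.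
    rewrite exchange_big /=; apply: eq_bigr => t' _.
    by rewrite scaler_sumr; apply: eq_bigr => q _; rewrite scalerA.
have := d0 t; rewrite /d (bigD1 t) //= c_Ex // eqxx mulr1 big1 ?addr0 //.
by move=> t' /andP[t'Ex t't]; rewrite c_Ex // eq_sym (negPf t't) mulr0.
Qed.

Lemma mu_moore s : (s < #|Ex|)%N -> \sum_(t in Ex) Y t * mu t ^+ (#|F| ^ s) = 0.
Proof.
rewrite card_Ex => lt_sh; rewrite -[RHS](Y_global lt_sh).
under [RHS]eq_bigr => q _ do rewrite Y_decomp mulr_suml.
rewrite [RHS]exchange_big /=; apply: eq_bigr => t _.
rewrite /mu expr_cardX_sum mulr_sumr; apply: eq_bigr => q _.
by rewrite exprZ_cardX -mulrA mulr_algl.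
Qed.

Lemma Y_eq0 q : Y q = 0.
Proof.
rewrite Y_decomp big1 // => t tEx.
by rewrite (moore_kernel mu_free mu_moore tEx) mul0r.
Qed.

End Selection.

Lemma loc_glob_MR : MR_condition (lrc_pcm (fun _ => loc_mx) glob_mx).
Proof.
move=> T Ex T_grp card_Ex Ex_T; set S := Ex :|: _.
apply: inj_row_free => y y_ker; pose e := @enum_val _ (mem S).
pose Y q := \sum_(l < #|S|) y 0 l * (e l == q)%:R.
have Ye l : Y (e l) = y 0 l.
  rewrite /Y (bigD1 l) //= eqxx mulr1 big1 ?addr0 // => l' l'l.
  by rewrite (inj_eq enum_val_inj) (negPf l'l) mulr0.
have [c c_spec] := corrections_exist T_grp Ex_T.
apply/rowP => l; rewrite mxE -Ye; apply: (Y_eq0 T_grp card_Ex Ex_T _ _ c_spec).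
  move=> q qS; apply: big1 => l' _.
  rewrite (_ : e l' == q = false) ?mulr0 //.
  by apply: contraNF qS => /eqP <-; apply: enum_valP.
move=> p; have /rowP/(_ p) := y_ker; rewrite !mxE => y_p; rewrite -[RHS]y_p.
under eq_bigr => q _ do rewrite mulr_suml.
rewrite exchange_big; apply: eq_bigr => l' _; rewrite [_^T _ _]mxE [colsub _ _ _ _]mxE.
rewrite (bigD1 (e l')) //= eqxx mulr1 big1 ?addr0 // => q /negPf ql.
by rewrite eq_sym ql mulr0 mul0r.
Qed.

Lemma loc_glob_MR_LRC : MR_LRC L g r h a.
Proof.
exists (fun=> loc_mx), glob_mx; split; last exact: loc_glob_MR.
by move=> i; apply: vander_MDS => // j j' /fmorph_inj/al_inj.
Qed.

End Construction.

Lemma exists_inj_ord (T : finType) n : (n <= #|T|)%N -> exists f : 'I_n -> T, injective f.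
Proof.
move=> le_nT; exists (fun i => enum_val (widen_ord le_nT i)).
by move=> i j /enum_val_inj /widen_ord_inj.
Qed.

Theorem MR_LRC_exists (F : finFieldType) g r h a w :
  (0 < a)%N -> (a <= r)%N -> (r <= #|F|)%N -> (r <= w)%N -> (g <= #|F| ^ w)%N ->
  (0 < minn h g)%N ->
  exists L : finFieldType, #|L| = (#|F| ^ (w * minn h g))%N /\ MR_LRC L g r h a.
Proof.
move=> a_gt0 a_le_r r_le_F r_le_w g_le_qw m_gt0.
have w_gt0 : (0 < w)%N by apply: leq_trans r_le_w; apply: leq_trans a_le_r.
have [E dim_E] := finFieldExt_exists F w_gt0.
have [L dim_L] : {L : fieldExtType F | \dim {:L} = minn h g * w}.
  by apply: finFieldExt_exists; rewrite muln_gt0 m_gt0.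
have [x x_inj] : exists x : 'I_g -> E, injective x.
  by apply: (exists_inj_ord (T := FinFieldExtType E)); rewrite card_finFieldExt dim_E.
have [al al_inj] := exists_inj_ord r_le_F.
exists (FinFieldExtType L); split; first by rewrite card_finFieldExt dim_L mulnC.
apply: (loc_glob_MR_LRC (m := minn h g)) x_inj al_inj _ _ _ a_gt0 a_le_r;
  by rewrite ?dim_E ?dim_L.
Qed.

Lemma up_log2_bounds r : (1 < r)%N -> (r <= 2 ^ up_log 2 r <= 2 * r)%N.
Proof.
move=> r_gt1; have [lt_r le_r] := andP (up_log_bounds (isT : (1 < 2)%N) r_gt1).
have u_gt0 : (0 < up_log 2 r)%N by rewrite up_log_gt0.
by rewrite le_r -(prednK u_gt0) expnS leq_mul2l /= ltnW.
Qed.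

Lemma field_size_bound r g q : (1 < r)%N -> (r <= q <= 2 * r)%N ->
  (q ^ maxn r (up_log q g) <= maxn (2 * g * (trunc_log 2 g).+1) ((2 * r) ^ r))%N.
Proof.
move=> r_gt1 /andP[r_le_q q_le_2r].
have q_gt1 : (1 < q)%N by apply: leq_trans r_le_q.
have [le_ur|lt_ru] := leqP (up_log q g) r.
  by rewrite leq_max leq_exp2r ?q_le_2r ?orbT // ltnW.
rewrite leq_max; apply/orP; left.
have g_gt1 : (1 < g)%N by move: lt_ru; case: g => [|[|g]] //; rewrite ?up_log0 ?up_log1.
have lt_g := up_log_gtn q_gt1 g_gt1.
have r_le_log : (r <= trunc_log 2 g)%N.
  apply: trunc_log_max => //; apply: leq_trans (ltnW lt_g).
  apply: (@leq_trans (q ^ r)); first by rewrite leq_exp2r ?q_gt1 // ltnW.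
  by rewrite leq_exp2l // -ltnS prednK // (leq_ltn_trans _ lt_ru).
rewrite -(prednK (leq_ltn_trans (leq0n r) lt_ru)) expnS.
apply: leq_trans (leq_mul q_le_2r (ltnW lt_g)) _.
by rewrite mulnAC leq_mul2l /= ltnW ?orbT // ltnS.
Qed.

Theorem theorem3p13 :
  exists C c : nat,
  forall a r h g n : nat,
    (0 < a)%N -> (0 < r)%N -> (0 < h)%N -> (0 < g)%N ->
    (g * a + h < g * r)%N -> n = (r * g)%N ->
    exists F : finFieldType,
      (#|F| <= (maxn (C * (n %/ r) * (trunc_log 2 (n %/ r)).+1 ^ c) ((2 * r) ^ r))
                ^ (minn h (n %/ r)))%N
      /\ MR_LRC F g r h a.
Proof.
exists 2%N, 1%N => a r h g n a_gt0 r_gt0 h_gt0 g_gt0 lt_n ->.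
rewrite mulKn // expn1.
have a_lt_r : (a < r)%N by rewrite -(ltn_pmul2l g_gt0); lia.
have r_gt1 : (1 < r)%N by lia.
have [F _ card_F] : {F : finFieldType | 2 \in [pchar F] & #|F| = (2 ^ up_log 2 r)%N}.
  by apply: pPrimePowerField; rewrite ?up_log_gt0.
have /andP[r_le_q q_le_2r] := up_log2_bounds r_gt1; rewrite -card_F in r_le_q q_le_2r.
have q_gt1 : (1 < #|F|)%N by apply: leq_trans r_le_q.
set w := maxn r (up_log #|F| g).
have g_le_qw : (g <= #|F| ^ w)%N.
  by apply: leq_trans (up_logP g q_gt1) _; rewrite leq_exp2l ?leq_maxr.
have m_gt0 : (0 < minn h g)%N by rewrite leq_min h_gt0.
have [L [card_L L_MR]] :=
  MR_LRC_exists a_gt0 (ltnW a_lt_r) r_le_q (leq_maxl _ _) g_le_qw m_gt0.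
exists L; split => //; rewrite card_L expnM leq_exp2r //.
by apply: field_size_bound; rewrite ?r_le_q.
Qed.
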